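(* Let $\mathcal{A}=(a_{ijk})$ be a 3rd order 3-dimensional real symmetric tensor with $a_{iii}>0$ for all $i\in\{1,2,3\}$. Assume that there exist $r,s,t\in\{1,2,3\}$ with $r\neq s$, $s\neq t$, $r\neq t$ such that $$\begin{aligned} &a_{rss}\ge\sqrt[3]{a_{rrr}a_{sss}^2},\quad a_{rtt}\ge\sqrt[3]{a_{rrr}a_{ttt}^2},\\ &a_{rrs}\ge-\sqrt[3]{a_{rrr}^2a_{sss}},\quad a_{rrt}\ge-\sqrt[3]{a_{rrr}^2a_{ttt}},\\ &a_{sst}\ge-\sqrt[3]{a_{sss}^2a_{ttt}},\quad a_{stt}\ge\sqrt[3]{a_{sss}a_{ttt}^2},\\ &a_{123}\ge\sqrt[3]{a_{111}a_{222}a_{333}}. \end{aligned}$$ Then $\mathcal{A}$ is strictly copositive.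
   Context: A 3rd order 3-dimensional real symmetric tensor is an array $\mathcal{A}=(a_{ijk})_{1\le i,j,k\le 3}$ of real numbers whose entries are invariant under every permutation of the indices. For $x=(x_1,x_2,x_3)^\top\in\mathbb{R}^3$ put $\mathcal{A}x^3=\sum_{i,j,k=1}^3 a_{ijk}x_ix_jx_k$. $\mathcal{A}$ is strictly copositive if $\mathcal{A}x^3>0$ for every $x\neq 0$ with $x_1,x_2,x_3\ge 0$. *)

(* Defs.v *)
From mathcomp Require Import all_boot all_order all_algebra all_fingroup.
From mathcomp Require Import reals exp.

Set Implicit Arguments.
Unset Strict Implicit.
Unset Printing Implicit Defensive.

Import Order.TTheory GRing.Theory Num.Theory.
Local Open Scope ring_scope.

Definition tensor3 (R : Type) (n : nat) : Type := 'I_n -> 'I_n -> 'I_n -> R.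

(* The index triple (i1, i2, i3) is i : 'I_3 -> 'I_n, and s permutes its
   three positions. *)
Definition symmetric_tensor (R : Type) (n : nat) (A : tensor3 R n) : Prop :=
  forall (s : 'S_3) (i : 'I_3 -> 'I_n),
    A (i (s 0)) (i (s 1)) (i (s 2)) = A (i 0) (i 1) (i 2).

Definition tensor_form (R : realType) (n : nat) (A : tensor3 R n)
    (x : 'cV[R]_n) : R :=
  \sum_(i < n) \sum_(j < n) \sum_(k < n) A i j k * x i 0 * x j 0 * x k 0.

Definition strictly_copositive (R : realType) (n : nat) (A : tensor3 R n) :
    Prop :=
  forall x : 'cV[R]_n,
    x != 0 -> (forall i, 0 <= x i 0) -> 0 < tensor_form A x.

(* This is the real cube root for x >= 0 only (powR takes other values on
   negative numbers). *)
Definition cbrt (R : realType) (x : R) : R := powR x 3^-1.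

(* Main.v *)
(* Writing u, v, w for the coordinates x_r, x_s, x_t scaled by the cube roots of
   the diagonal entries, the hypotheses bound the form below by
     (u - v - w)^3 + 2 v^3 + 2 w^3 + 6 v w^2
       = u q(u, v + w) + v q(v, w) + w^3,   q(y, z) = y^2 - 3 y z + 3 z^2,
   and q is a positive definite quadratic form. *)
Require Import Defs.
From mathcomp Require Import all_boot all_order all_algebra all_fingroup.
From mathcomp Require Import reals exp.
From mathcomp Require Import ring lra.

Import Order.TTheory GRing.Theory Num.Theory.
Local Open Scope ring_scope.

Lemma cbrt_gt0 {R : realType} {x : R} : 0 < x -> 0 < cbrt x.
Proof. exact: powR_gt0. Qed.

Lemma cbrtK {R : realType} {x : R} : 0 <= x -> cbrt x ^+ 3 = x.
Proof.
by move=> x_ge0; rewrite /cbrt -powR_mulrn ?powR_ge0// -powRrM mulVf ?powRr1 ?pnatr_eq0.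
Qed.

Lemma cbrtM {R : realType} {x y : R} :
  0 <= x -> 0 <= y -> cbrt (x * y) = cbrt x * cbrt y.
Proof. exact: powRM. Qed.

Lemma symmetric_swap12 {R : Type} {n : nat} {A : tensor3 R n} :
  symmetric_tensor A -> forall i j k, A i j k = A j i k.
Proof.
(* The default of [nth] serves as the third entry, so the function is the triple [(j, i, k)]. *)
move=> A_sym i j k; have := A_sym (tperm 0 1) (fun l => nth k [:: j; i] l).
by rewrite tpermL tpermR tpermD.
Qed.

Lemma symmetric_swap23 {R : Type} {n : nat} {A : tensor3 R n} :
  symmetric_tensor A -> forall i j k, A i j k = A i k j.
Proof.
move=> A_sym i j k; have := A_sym (tperm 1 2) (fun l => nth j [:: i; k] l).
by rewrite tpermL tpermR tpermD.
Qed.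

Lemma perm_of_distinct {r s t : 'I_3} : r != s -> s != t -> r != t ->
  exists p : 'S_3, [/\ p 0 = r, p 1 = s & p 2 = t].
Proof.
move=> rs st rt; pose f (i : 'I_3) := nth t [:: r; s] i.
have f_inj : injective f.
  move=> [[|[|[|//]]] ?] [[|[|[|//]]] ?] /=; rewrite /f /= => /eqP e;
    try exact: val_inj; by move: e rs st rt; rewrite ?[_ == r]eq_sym ?[t == s]eq_sym => ->.
by exists (perm f_inj); rewrite !permE.
Qed.

(** A permutation carrying [0, 1, 2] to [r, s, t] reindexes the sums; symmetry then merges the 27
    terms into ten classes of sizes 1, 3 and 6. *)
Lemma tensor_form_distinct {R : realType} {A : tensor3 R 3} (x : 'cV[R]_3)
    {r s t : 'I_3} :
    symmetric_tensor A -> r != s -> s != t -> r != t ->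
  tensor_form A x =
    A r r r * x r 0 ^+ 3 + A s s s * x s 0 ^+ 3 + A t t t * x t 0 ^+ 3
    + 3 * (A r s s * (x r 0 * x s 0 ^+ 2) + A r t t * (x r 0 * x t 0 ^+ 2)
           + A r r s * (x r 0 ^+ 2 * x s 0) + A r r t * (x r 0 ^+ 2 * x t 0)
           + A s s t * (x s 0 ^+ 2 * x t 0) + A s t t * (x s 0 * x t 0 ^+ 2))
    + 6 * (A 0 1 2 * (x r 0 * x s 0 * x t 0)).
Proof.
move=> A_sym rs st rt; have [p [p0 p1 p2]] := perm_of_distinct rs st rt.
have sum3 (F : 'I_3 -> R) : \sum_i F i = F r + F s + F t.
  rewrite (reindex_inj (@perm_inj _ p)) /= !big_ord_recl big_ord0 addr0 addrA.
  by rewrite -p0 -p1 -p2; congr (_ + F (p _) + F (p _)); exact: val_inj.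
(* Symmetry at the identity triple turns [A 0 1 2] into [A r s t]. *)
have /= <- := A_sym p id; rewrite p0 p1 p2.
have S12 := symmetric_swap12 A_sym; have S23 := symmetric_swap23 A_sym.
rewrite /tensor_form !sum3.
(* Indices are sorted in the order [r, s, t]. Some swaps recur because sorting one entry can
   recreate an unsorted one already treated. *)
rewrite (S23 r s r) (S12 s r r) (S23 r s r) (S12 s r s) (S23 s s r) (S12 s r s).
rewrite (S23 r t r) (S12 t r r) (S23 r t r) (S12 t r t) (S23 t t r) (S12 t r t).
rewrite (S23 s t s) (S12 t s s) (S23 s t s) (S12 t s t) (S23 t t s) (S12 t s t).
rewrite (S12 t s r) (S23 s t r) (S12 s r t) (S12 t r s) (S23 r t s).
ring.
Qed.

Lemma corner_cubic_gt0 {R : realFieldType} {u v w : R} :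
  0 <= u -> 0 <= v -> 0 <= w -> [|| 0 < u, 0 < v | 0 < w] ->
  0 < u ^+ 3 + v ^+ 3 + w ^+ 3
      + 3 * (u * v ^+ 2 + u * w ^+ 2 - u ^+ 2 * v - u ^+ 2 * w
             - v ^+ 2 * w + v * w ^+ 2)
      + 6 * (u * v * w).
Proof.
move=> u_ge0 v_ge0 w_ge0 uvw_gt0.
pose q (y z : R) := y ^+ 2 - 3 * y * z + 3 * z ^+ 2.
(* The difference of the two sides is [3 / 4 * (y - 2 * z) ^+ 2]. *)
have q_ge (y z : R) : y ^+ 2 / 4 <= q y z.
  have := sqr_ge0 (y - 2 * z); rewrite /q; nra.
have q_gt0 (y z : R) : 0 < y -> 0 < y * q y z.
  by move=> y_gt0; rewrite mulr_gt0// (lt_le_trans _ (q_ge y z))// divr_gt0// exprn_gt0.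
have q_ge0 (y z : R) : 0 <= y -> 0 <= y * q y z.
  by rewrite le_eqVlt => /predU1P[<-|/q_gt0/ltW//]; rewrite mul0r.
have w3_ge0 := exprn_ge0 3 w_ge0.
rewrite [ltRHS](_ : _ = u * q u (v + w) + v * q v w + w ^+ 3); last first.
  by rewrite /q; ring.
have U := q_ge0 u (v + w) u_ge0; have V := q_ge0 v w v_ge0.
(* Whichever variable is positive makes its own summand positive; the other two summands are
   nonnegative. *)
case/or3P: uvw_gt0 => [/q_gt0-/(_ (v + w))|/q_gt0-/(_ w)|/(exprn_gt0 3)]; lra.
Qed.

(* The indices 1, 2, 3 are the elements 0, 1, 2 of 'I_3. *)
Theorem corollary3p6 (R : realType) (A : tensor3 R 3)
    (A_sym : symmetric_tensor A)
    (A_diag : forall i : 'I_3, 0 < A i i i)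
    (A_entries : exists r s t : 'I_3,
      [/\ r != s, s != t & r != t] /\
      [/\ cbrt (A r r r * A s s s ^+ 2) <= A r s s,
          cbrt (A r r r * A t t t ^+ 2) <= A r t t,
          - cbrt (A r r r ^+ 2 * A s s s) <= A r r s
        & - cbrt (A r r r ^+ 2 * A t t t) <= A r r t] /\
      [/\ - cbrt (A s s s ^+ 2 * A t t t) <= A s s t,
          cbrt (A s s s * A t t t ^+ 2) <= A s t t
        & cbrt (A 0 0 0 * A 1 1 1 * A 2 2 2) <= A 0 1 2]) :
  strictly_copositive A.
Proof.
move=> x x_neq0 x_ge0.
case: A_entries => r [s [t [[rs st rt] [[rss rtt rrs rrt] [sst stt e123]]]]].
rewrite (tensor_form_distinct x A_sym rs st rt).
have diag_ge0 i : 0 <= A i i i by exact: ltW.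
have diagE i : A i i i = cbrt (A i i i) ^+ 3 by rewrite cbrtK.
(* The bound on [A 0 1 2] is brought to the indices [r, s, t], where its cube root factors like the
   others. *)
have diag123 : A 0 0 0 * A 1 1 1 * A 2 2 2 = A r r r * A s s s * A t t t.
  have [p [<- <- <-]] := perm_of_distinct rs st rt.
  have prod3 (F : 'I_3 -> R) : F 0 * F 1 * F 2 = \prod_i F i.
    rewrite !big_ord_recl big_ord0 mulr1 mulrA.
    by congr (_ * F _ * F _); exact: val_inj.
  rewrite (prod3 (fun i => A i i i)) (prod3 (fun i => A (p i) (p i) (p i))).
  exact/reindex_inj/perm_inj.
rewrite diag123 in e123.
rewrite !expr2 !cbrtM ?mulr_ge0// in rss rtt rrs rrt sst stt e123.
have a_gt0 := cbrt_gt0 (A_diag r).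
have b_gt0 := cbrt_gt0 (A_diag s).
have c_gt0 := cbrt_gt0 (A_diag t).
rewrite (diagE r) (diagE s) (diagE t).
(* With the cube roots as free positive parameters, every hypothesis is polynomial. *)
move: (cbrt (A r r r)) (cbrt (A s s s)) (cbrt (A t t t)) => a b c
  in rss rtt rrs rrt sst stt e123 a_gt0 b_gt0 c_gt0 *.
have [y_ge0 z_ge0 w_ge0] := And3 (x_ge0 r) (x_ge0 s) (x_ge0 t).
have xyz_gt0 : [|| 0 < x r 0, 0 < x s 0 | 0 < x t 0].
  apply: contra_neqT x_neq0; rewrite !negb_or -!leNgt => /and3P[r0 s0 t0].
  apply/colP => i; apply/eqP; rewrite mxE eq_le x_ge0 andbT.
  (* Three distinct indices exhaust ['I_3], so all coordinates of [x] would vanish. *)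
  suff /or3P[] : [|| i == r, i == s | i == t] by move=> /eqP->.
  move: rs st rt; clear.
  by move: i r s t => [[|[|[|//]]] ?] [[|[|[|//]]] ?] [[|[|[|//]]] ?] [[|[|[|//]]] ?].
move: (x r 0) (x s 0) (x t 0) => y z w in y_ge0 z_ge0 w_ge0 xyz_gt0 *.
have uvw_gt0 : [|| 0 < a * y, 0 < b * z | 0 < c * w] by rewrite !pmulr_rgt0.
have cubic_gt0 := corner_cubic_gt0 (mulr_ge0 (ltW a_gt0) y_ge0)
  (mulr_ge0 (ltW b_gt0) z_ge0) (mulr_ge0 (ltW c_gt0) w_ge0) uvw_gt0.
apply: lt_le_trans cubic_gt0 _.
(* The form minus the cubic at [a * y], [b * z], [c * w] is a combination, with weights 3 and 6, of
   the entry bounds times their nonnegative monomials. *)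
have monom (p q m e f : R) : 0 <= p -> 0 <= q -> 0 <= m -> e <= f ->
    e * (p * q * m) <= f * (p * q * m).
  by move=> p_ge0 q_ge0 m_ge0; apply: ler_wpM2r; rewrite !mulr_ge0.
have := monom _ _ _ _ _ y_ge0 z_ge0 z_ge0 rss.
have := monom _ _ _ _ _ y_ge0 w_ge0 w_ge0 rtt.
have := monom _ _ _ _ _ y_ge0 y_ge0 z_ge0 rrs.
have := monom _ _ _ _ _ y_ge0 y_ge0 w_ge0 rrt.
have := monom _ _ _ _ _ z_ge0 z_ge0 w_ge0 sst.
have := monom _ _ _ _ _ z_ge0 w_ge0 w_ge0 stt.
have := monom _ _ _ _ _ y_ge0 z_ge0 w_ge0 e123.
clear; lra.
Qed.
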